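(* Let $r>0$ and let $\mu$ be an in-homogeneous self-similar measure on $\mathbb{R}^q$ belonging to Case (i) or Case (ii) (as defined in the context), with associated numbers $\xi_{1,r},\xi_{2,r}>0$ and $\xi_r=\max\{\xi_{1,r},\xi_{2,r}\}$. If $\xi_{1,r}<\xi_{2,r}$, then $\overline{Q}_r^{\xi_r}(\mu)<\infty$.
   Context: **In-homogeneous self-similar measures (ISM).** Let $N\ge 2$ and let $(f_i)_{i=1}^N$ be contractive similitudes on $\mathbb{R}^q$ with contraction ratios $(s_i)_{i=1}^N$, $s_i\in(0,1)$. Let $E$ be the associated self-similar set, i.e. the unique non-empty compact set with $E=f_1(E)\cup\cdots\cup f_N(E)$. Let $\nu$ be a Borel probability measure on $\mathbb{R}^q$ with compact support $C$, and $(p_i)_{i=0}^N$ a probability vector with $p_i>0$ for all $0\le i\le N$. There is a unique Borel probability measure $\mu$ with $\mu=p_0\nu+\sum_{i=1}^N p_i\,\mu\circ f_i^{-1}$; it is called the ISM associated with $(f_i)_{i=1}^N$, $(p_i)_{i=0}^N$ and $\nu$. For contractive similitudes $(g_i)_{i=1}^M$ and a probability vector $(t_i)_{i=1}^M$, the associated self-similar measure is the unique Borel probability measure $\nu$ with $\nu=\sum_{i=1}^M t_i\,\nu\circ g_i^{-1}$. The family $(g_i)_{i=1}^M$ satisfies the open set condition (OSC) if there is a non-empty bounded open set $U$ such that the sets $g_i(U)$, $1\le i\le M$, are pairwise disjoint and $\bigcup_{i=1}^M g_i(U)\subset U$. **Case (i).** $(f_i)_{i=1}^N$ satisfies the OSC,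 and $\nu$ is the self-similar measure associated with the same family $(f_i)_{i=1}^N$ and a probability vector $(t_i)_{i=1}^N$ with all $t_i>0$. In this case $\xi_{1,r},\xi_{2,r}$ are the positive numbers defined by $$\sum_{i=1}^N(t_is_i^r)^{\frac{\xi_{1,r}}{\xi_{1,r}+r}}=1,\qquad \sum_{i=1}^N(p_is_i^r)^{\frac{\xi_{2,r}}{\xi_{2,r}+r}}=1.$$ **Case (ii).** $M\ge 2$, $(g_i)_{i=1}^M$ are contractive similitudes on $\mathbb{R}^q$ with contraction ratios $(c_i)_{i=1}^M$ satisfying the OSC, $\nu$ is the self-similar measure associated with $(g_i)_{i=1}^M$ and a probability vector $(t_i)_{i=1}^M$ with all $t_i>0$ (so $C$ is the self-similar set of $(g_i)_{i=1}^M$), and there exists a bounded non-empty open set $U\subset\mathbb{R}^q$ such that (1) $\bigcup_{i=1}^N f_i(U)\subset U$ and $f_i(U)\cap f_j(U)=\emptyset$ for $1\le i\ne j\le N$; (2) $E\cap U\ne\emptyset$ and $C\subset U$; (3) $\nu(\partial U)=0$, and $C\cap f_i(\mathrm{cl}(U))=\emptyset$ for all $1\le i\le N$. In this case $\xi_{1,r},\xi_{2,r}$ are the positive numbers defined by $$\sum_{i=1}^M(t_ic_i^r)^{\frac{\xi_{1,r}}{\xi_{1,r}+r}}=1,\qquad \sum_{i=1}^N(p_is_i^r)^{\frac{\xi_{2,r}}{\xi_{2,r}+r}}=1.$$ In both cases $\xi_r:=\max\{\xi_{1,r},\xi_{2,r}\}$. **Quantization.** For a Borel probability measure $P$ on $\mathbb{R}^q$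 and $n\ge1$, the $n$th quantization error of order $r$ is $$e_{n,r}(P)=\inf_{\alpha\subset\mathbb{R}^q,\ 1\le \mathrm{card}(\alpha)\le n}\Big(\int d(x,\alpha)^r\,dP(x)\Big)^{1/r},$$ where $d(x,\alpha)$ is the Euclidean distance from $x$ to $\alpha$; $e_{n,r}^r(P)$ denotes $(e_{n,r}(P))^r$. For $s>0$ the $s$-dimensional upper quantization coefficient of order $r$ is $\overline{Q}_r^s(P)=\limsup_{n\to\infty}n^{r/s}e_{n,r}^r(P)$. *)

(* Defs.v *)
From HB Require Import structures.
From mathcomp Require Import all_boot all_order all_algebra.
From mathcomp Require Import all_classical all_reals all_analysis.

Set Implicit Arguments.
Unset Strict Implicit.
Unset Printing Implicit Defensive.

Import Order.TTheory GRing.Theory Num.Theory.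
Import numFieldNormedType.Exports.

Local Open Scope classical_set_scope.
Local Open Scope card_scope.
Local Open Scope ring_scope.

(* The library's norm on 'rV[R]_q is the sup norm. It only serves for the
   topology and for boundedness, which are the Euclidean ones; distances are
   measured by [edist]. *)
Definition edist (R : realType) (q : nat) (x y : 'rV[R]_q) : R :=
  Num.sqrt (\sum_(i < q) (x ord0 i - y ord0 i) ^+ 2).

Definition edist_set (R : realType) (q : nat) (x : 'rV[R]_q)
    (A : set 'rV[R]_q) : R :=
  inf [set edist x a | a in A].

(* R^q with its Borel sigma-algebra. *)
Notation borel R q := (g_sigma_algebraType (@open 'rV[R]_q)).

Definition measure_support (R : realType) (q : nat) (P : probability (borel R q) R) :
    set 'rV[R]_q :=
  [set x | forall V : set 'rV[R]_q, open V -> V x -> (0 < P V)%E].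

Definition boundary (T : topologicalType) (U : set T) : set T :=
  closure U `\` interior U.

Definition contractive_similitude (R : realType) (q : nat) (s : R)
    (f : 'rV[R]_q -> 'rV[R]_q) : Prop :=
  0 < s < 1 /\ forall x y, edist (f x) (f y) = s * edist x y.

Definition prob_vector (R : realType) (n : nat) (p : 'I_n -> R) : Prop :=
  (forall i, 0 <= p i) /\ \sum_(i < n) p i = 1.

Definition self_similar_set (R : realType) (q N : nat)
    (f : 'I_N -> 'rV[R]_q -> 'rV[R]_q) (E : set 'rV[R]_q) : Prop :=
  [/\ compact E, E !=set0 & E = \bigcup_(i in [set: 'I_N]) (f i @` E)].

Definition self_similar_measure (R : realType) (q M : nat)
    (g : 'I_M -> 'rV[R]_q -> 'rV[R]_q) (t : 'I_M -> R)
    (nu : probability (borel R q) R) : Prop :=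
  forall A : set (borel R q), measurable A ->
    nu A = (\sum_(i < M) (t i)%:E * pushforward nu (g i : borel R q -> borel R q) A)%E.

Definition osc_open_set (R : realType) (q M : nat)
    (g : 'I_M -> 'rV[R]_q -> 'rV[R]_q) (U : set 'rV[R]_q) : Prop :=
  [/\ U !=set0, bounded_set U, open U,
      trivIset [set: 'I_M] (fun i => g i @` U)
    & \bigcup_(i in [set: 'I_M]) (g i @` U) `<=` U].

Definition open_set_condition (R : realType) (q M : nat)
    (g : 'I_M -> 'rV[R]_q -> 'rV[R]_q) : Prop :=
  exists U : set 'rV[R]_q, osc_open_set g U.

(* The weights are p_0, ..., p_N: [p ord0] is the weight of [nu], and
   [p (lift ord0 i)] the weight of the i-th map. *)
Record ISM (R : realType) (q N : nat) (f : 'I_N -> 'rV[R]_q -> 'rV[R]_q)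
    (s : 'I_N -> R) (p : 'I_N.+1 -> R)
    (nu mu : probability (borel R q) R) : Prop := {
  ISM_card : (2 <= N)%N;
  ISM_similitude : forall i, contractive_similitude (s i) (f i);
  ISM_prob_vector : prob_vector p;
  ISM_weight_gt0 : forall i, 0 < p i;
  ISM_compact_support : compact (measure_support nu);
  ISM_eq : forall A : set (borel R q), measurable A ->
    mu A = ((p ord0)%:E * nu A +
      \sum_(i < N) (p (lift ord0 i))%:E *
        pushforward mu (f i : borel R q -> borel R q) A)%E }.

Definition xi_eq (R : realType) (n : nat) (t c : 'I_n -> R) (r xi : R) : Prop :=
  0 < xi /\ \sum_(i < n) (t i * c i `^ r) `^ (xi / (xi + r)) = 1.

(* The number xi_{1,r} depends on the vector t (and on the maps g) attached to
   the case, so its defining equation is part of [caseI] and [caseII]. *)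
Definition caseI (R : realType) (q N : nat) (f : 'I_N -> 'rV[R]_q -> 'rV[R]_q)
    (s : 'I_N -> R) (nu : probability (borel R q) R) (r xi1 : R) : Prop :=
  open_set_condition f /\
  exists t : 'I_N -> R,
    [/\ prob_vector t, forall i, 0 < t i, self_similar_measure f t nu
      & xi_eq t s r xi1].

Definition caseII (R : realType) (q N : nat) (f : 'I_N -> 'rV[R]_q -> 'rV[R]_q)
    (nu : probability (borel R q) R) (r xi1 : R) : Prop :=
  (exists (M : nat) (g : 'I_M -> 'rV[R]_q -> 'rV[R]_q) (c t : 'I_M -> R),
    [/\ (2 <= M)%N,
        forall i, contractive_similitude (c i) (g i),
        open_set_condition g
      & [/\ prob_vector t, forall i, 0 < t i, self_similar_measure g t nu
          & xi_eq t c r xi1]]) /\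
  (exists E U : set 'rV[R]_q,
    [/\ self_similar_set f E,
        osc_open_set f U,
        E `&` U !=set0 /\ measure_support nu `<=` U
      & nu (boundary U) = 0%E /\
        forall i, measure_support nu `&` f i @` closure U = set0]).

Definition quant_error (R : realType) (q : nat) (r : R)
    (P : probability (borel R q) R) (n : nat) : \bar R :=
  ereal_inf [set (poweR (\int[P]_x ((edist_set x A) `^ r)%:E) r^-1)%E
            | A in [set A : set 'rV[R]_q | A !=set0 /\ A #<= `I_n]].

Definition upper_quant_coef (R : realType) (q : nat) (r s : R)
    (P : probability (borel R q) R) : \bar R :=
  limn_esup (fun n => ((n%:R `^ (r / s))%:E * poweR (quant_error r P n) r)%E).

(* Main.v *)
Require Import Defs.
From HB Require Import structures.
From mathcomp Require Import all_boot all_order all_algebra.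
From mathcomp Require Import all_classical all_reals all_analysis.
From mathcomp Require Import measurable_realfun.
From mathcomp Require Import ring lra.

Import Order.TTheory GRing.Theory Num.Theory.
Import numFieldNormedType.Exports.

Local Open Scope classical_set_scope.
Local Open Scope ring_scope.

(** In both cases [nu] is self-similar for some maps [g_i] with ratios [c_i]
and weights [t_i], and [mu] is a mixture of [nu] and of its own images under
the [f_i], with weights [p_0, ..., p_N]. Quantizers transport along such
mixtures ([achievable_mixture]): if [a_k] is a finite set of size [n_k] and
cost [v_k], where the cost is the integral of the [r]-th power of the distance
to the set, then the union of the images of the [a_k] has size at most
[sum n_k] and cost at most [sum w_k * s_k^r * v_k]. So the weights [w_k] and
the ratios [s_k] enter only through [h_k := w_k * s_k^r].

Put [eta := xi / (xi + r)], so that [sum h_k^eta = 1] is the equation of [xi].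
A family of quantizers, indexed by a scale [x >= 1], of size [O(x^eta)] and
cost [O(x^(eta - 1))] is what is wanted: [n ~ x^eta] gives the cost
[O(n^(-r/xi))], because [(1 - eta) / eta = r / xi] ([upper_quant_coef_lty]).
Feeding the [k]-th piece with the quantizer at scale [x * h_k] multiplies both
bounds by [sum h_k^eta = 1], so the bounds at smaller scales reproduce
themselves at scale [x]. For [nu] this is an induction on the scale.

For [mu] each step also adds the quantizer of [nu] at scale [x], whose size
and cost are [a * x^eta1] and [a * x^(eta1 - 1)], with [eta1 < eta]. These
contributions would accumulate, but [sum h_k^eta1 > 1] since [h_k < 1], and so
the strengthened bounds [A * x^eta - B * x^eta1] and
[A * x^(eta - 1) - B * x^(eta1 - 1)] are stable once
[B * (sum h_k^eta1 - 1) >= a] ([renewal]). This is where [xi1 < xi2] matters.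

The induction starts from a single point, whose cost is finite because [nu]
and [mu] have bounded support. This is read off from the mixture equation
([bounded_mixture]), the maps being contractions. *)

(* The Euclidean distance, as opposed to the extended distance of the same
   name on a pseudometric space. *)
Local Notation edist := Defs.edist.

(** * The Euclidean distance *)

Lemma cauchy_schwarz_sum {R : realFieldType} {n : nat} (a b : 'I_n -> R) :
  (\sum_i a i * b i) ^+ 2 <= (\sum_i a i ^+ 2) * (\sum_i b i ^+ 2).
Proof.
set S := \sum_i a i * b i; set A := \sum_i a i ^+ 2; set B := \sum_i b i ^+ 2.
(* Expand the square of [B a - S b] with [S] the scalar product. *)
have key : \sum_i (B * a i - S * b i) ^+ 2 = B * (A * B - S ^+ 2).
  transitivity (B ^+ 2 * A - B * S *+ 2 * S + S ^+ 2 * B); last by ring.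
  rewrite [X in X - _]mulr_sumr [X in _ - X]mulr_sumr [X in _ + X]mulr_sumr.
  rewrite -sumrB -big_split /=.
  by apply: eq_bigr => i _; ring.
have /orP[B0|B0] : (B == 0) || (0 < B).
  by rewrite eq_sym -le_eqVlt sumr_ge0// => i _; exact: sqr_ge0.
  have b0 i : b i = 0.
    apply/eqP; rewrite -sqrf_eq0.
    move: B0; rewrite psumr_eq0 => [/allP/(_ i)|j _]; last exact: sqr_ge0.
    by apply; rewrite mem_index_enum.
  have -> : S = 0 by rewrite /S big1 // => i _; rewrite b0 mulr0.
  by rewrite expr0n /= mulr_ge0 // sumr_ge0 // => i _; exact: sqr_ge0.
rewrite -subr_ge0 -(pmulr_rge0 _ B0) -key.
by apply: sumr_ge0 => i _; exact: sqr_ge0.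
Qed.

Section Euclidean.
Context {R : realType} {q : nat}.
Implicit Types x y z : 'rV[R]_q.

Lemma edist_ge0 x y : 0 <= edist x y.
Proof. exact: sqrtr_ge0. Qed.

Lemma edistC x y : edist x y = edist y x.
Proof.
by congr (Num.sqrt _); apply: eq_bigr => i _; rewrite -sqrrN opprB.
Qed.

Lemma edist_triangle y x z : edist x z <= edist x y + edist y z.
Proof.
rewrite /edist; set a := fun i => x ord0 i - y ord0 i.
set b := fun i => y ord0 i - z ord0 i.
have A0 : 0 <= \sum_i a i ^+ 2 by apply: sumr_ge0 => i _; exact: sqr_ge0.
have B0 : 0 <= \sum_i b i ^+ 2 by apply: sumr_ge0 => i _; exact: sqr_ge0.
rewrite -[leRHS]ger0_norm ?addr_ge0 ?sqrtr_ge0 // -sqrtr_sqr.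
apply: ler_wsqrtr.
rewrite sqrrD !sqr_sqrtr // -sqrtrM //.
have -> : \sum_i (x ord0 i - z ord0 i) ^+ 2 =
    \sum_i a i ^+ 2 + (\sum_i a i * b i) *+ 2 + \sum_i b i ^+ 2.
  rewrite -sumrMnl -!big_split /=.
  by apply: eq_bigr => i _; rewrite /a /b; ring.
rewrite lerD2r lerD2l lerMn2r /=.
apply: le_trans (ler_norm _) _.
by rewrite -sqrtr_sqr ler_wsqrtr // cauchy_schwarz_sum.
Qed.

Lemma coord_le_edist x y (i : 'I_q) : `|x ord0 i - y ord0 i| <= edist x y.
Proof.
rewrite -sqrtr_sqr ler_wsqrtr // (bigD1 i) //= lerDl.
by apply: sumr_ge0 => j _; exact: sqr_ge0.
Qed.

Lemma near_edist x (e : R) : 0 < e -> \forall y \near x, edist x y < e.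
Proof.
move=> e0.
have n0 : 0 < Num.sqrt q.+1%:R :> R by rewrite sqrtr_gt0 ltr0n.
apply/nbhs_ballP; exists (e / Num.sqrt q.+1%:R); first by rewrite /= divr_gt0.
move=> y /= [_ xy].
rewrite -[e]ger0_norm ?ltW// -sqrtr_sqr ltr_sqrt ?exprn_gt0//.
apply: (@le_lt_trans _ _ (\sum_(i < q) (e / Num.sqrt q.+1%:R) ^+ 2)).
  apply: ler_sum => i _; have := xy ord0 i; rewrite /ball /= => xyi.
  by rewrite -[leLHS]real_normK ?num_real// ler_sqr ?nnegrE// ltW// divr_gt0.
rewrite sumr_const card_ord expr_div_n sqr_sqrtr// -mulrnAl.
rewrite ltr_pdivrMr ?ltr0n// -mulr_natr ltr_pM2l ?exprn_gt0//.
by rewrite ltr_nat.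
Qed.

(** The sigma-algebra is generated by the open sets of the sup norm, hence the
detour through continuity, for which the comparison of the Euclidean distance
with the sup norm in [near_edist] and [coord_le_edist] is enough. *)
Lemma measurable_lipschitz_real (phi : 'rV[R]_q -> R) :
    (forall x y, `|phi x - phi y| <= edist x y) ->
  measurable_fun setT (phi : borel R q -> R).
Proof.
move=> lip.
have cphi : continuous phi.
  move=> x; apply/(@cvgrPdist_lt _ _ _ _ (nbhs_filter x)) => e e0.
  by apply: filterS (near_edist x _ e0) => y; exact/le_lt_trans/lip.
apply: (measurability _ (RGenOpens.measurableE R)).
move=> _ [_ [a [b ->] <-]]; rewrite setTI.
apply: sub_sigma_algebra; move/continuousP : cphi; apply.
exact: interval_open.
Qed.

Lemma measurable_lipschitz (s : R) (g : 'rV[R]_q -> 'rV[R]_q) :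
    (forall x y, edist (g x) (g y) = s * edist x y) ->
  measurable_fun setT (g : borel R q -> borel R q).
Proof.
move=> lip.
have cg : continuous g.
  move=> x; apply/(@cvg_ballP _ _ _ _ (nbhs_filter x)) => e e0.
  have s0 : 0 < `|s| + 1 by rewrite ltr_wpDl.
  have e1 : 0 < (`|s| + 1)^-1 * e by rewrite mulr_gt0 ?invr_gt0.
  apply: filterS (near_edist x _ e1) => y xy.
  split=> // i j; rewrite (ord1 i) /ball/=.
  apply: le_lt_trans (coord_le_edist _ _ _) _; rewrite lip.
  apply: (@le_lt_trans _ _ ((`|s| + 1) * edist x y)).
    by rewrite ler_wpM2r ?edist_ge0// (le_trans (ler_norm _))// lerDl.
  by rewrite -ltr_pdivlMl.
have defB : @measurable _ (borel R q) = <<s @open 'rV[R]_q >> by [].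
apply: (measurability _ defB) => _ [A oA <-]; rewrite setTI.
by apply: sub_sigma_algebra; move/continuousP : cg; exact.
Qed.

End Euclidean.

(** * Integrals against mixtures *)

Lemma integral_mixture {d : measure_display} {T : measurableType d}
    {R : realType} {K : nat} (w : 'I_K.+1 -> R)
    (Q : 'I_K.+1 -> probability T R) (g : 'I_K.+1 -> T -> T)
    (P : probability T R) (F : T -> \bar R) :
    (forall k, 0 <= w k) -> (forall k, measurable_fun setT (g k)) ->
    (forall A, measurable A ->
      P A = (\sum_k (w k)%:E * pushforward (Q k) (g k) A)%E) ->
    measurable_fun setT F -> (forall x, 0 <= F x)%E ->
  (\int[P]_x F x = \sum_k (w k)%:E * \int[Q k]_x F (g k x))%E.
Proof.
move=> w0 mg PE mF F0.
(* Sums of measures are indexed by [nat]; [inord] is inert below [K.+1]. *)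
pose gm n : {mfun T >-> T} :=
  HB.pack (g (inord n)) (isMeasurableFun.Build _ _ _ _ _ (mg (inord n))).
pose m n : {measure set T -> \bar R} :=
  mscale (NngNum (w0 (inord n))) (distribution (Q (inord n)) (gm n)).
rewrite (@eq_measure_integral _ _ _ setT (msum m K.+1)); last first.
  move=> A mA _; apply: etrans (PE A mA) _; rewrite /msum.
  apply: eq_bigr => k _.
  by rewrite /m /= /mscale /= /distribution /pushforward /= inord_val.
rewrite ge0_integral_measure_sum//; apply: eq_bigr => k _.
rewrite ge0_integral_mscale//= inord_val; congr (_ * _)%E.
rewrite ge0_integral_distribution//.
by apply: eq_integral => x _ /=; rewrite inord_val.
Qed.

(** * Distance to a set *)

Section DistanceToSet.
Context {R : realType} {q : nat}.
Implicit Types (x y : 'rV[R]_q) (A : set 'rV[R]_q).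

Lemma edist_set_le {A} x a : A a -> edist_set x A <= edist x a.
Proof.
move=> Aa; apply: ge_inf; last by exists a.
by exists 0 => _ [b _ <-]; exact: edist_ge0.
Qed.

Lemma le_edist_set {A} x (c : R) : A !=set0 ->
  (forall a, A a -> c <= edist x a) -> c <= edist_set x A.
Proof.
move=> [a Aa] cA; apply: lb_le_inf; first by exists (edist x a); exists a.
by move=> _ [b Ab <-]; exact: cA.
Qed.

Lemma edist_set_ge0 x A : A !=set0 -> 0 <= edist_set x A.
Proof. by move=> A0; apply: le_edist_set => // a _; exact: edist_ge0. Qed.

Lemma edist_set_lipschitz x y A : A !=set0 ->
  `|edist_set x A - edist_set y A| <= edist x y.
Proof.
move=> A0; have half u v : edist_set u A - edist_set v A <= edist u v.
  rewrite lerBlDl -lerBlDr; apply: le_edist_set => // a Aa.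
  rewrite lerBlDr addrC.
  exact: le_trans (edist_set_le u _ Aa) (edist_triangle v u a).
by rewrite ler_norml half andbT lerNl opprB edistC half.
Qed.

Lemma measurable_edist_set_powR A (r : R) : A !=set0 ->
  measurable_fun setT (fun x : borel R q => ((edist_set x A) `^ r)%:E).
Proof.
move=> A0; apply/measurable_EFinP.
apply: (@measurableT_comp _ _ _ _ _ _ (@powR R ^~ r)).
  exact: measurable_powR.
by apply: measurable_lipschitz_real => x y; exact: edist_set_lipschitz.
Qed.

End DistanceToSet.

(** * Quantizers of mixtures *)

Section Mixtures.
Context {R : realType} {q : nat}.

(** The measures [Q k] may differ from [P] and from one another, so that the
same notion covers a self-similar measure (all [Q k] equal to [P]) and an
in-homogeneous one (one of them is [nu], moved by the identity). *)
Definition mixture {K : nat} (w : 'I_K -> R)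
    (Q : 'I_K -> probability (borel R q) R)
    (g : 'I_K -> 'rV[R]_q -> 'rV[R]_q) (P : probability (borel R q) R) : Prop :=
  forall A : set (borel R q), measurable A ->
    P A = (\sum_k (w k)%:E *
      pushforward (Q k) (g k : borel R q -> borel R q) A)%E.

(** The size bound [n] is real, to be compared with powers of the scale
without rounding. *)
Definition achievable (r : R) (P : probability (borel R q) R) (n v : R) :
    Prop :=
  exists a : seq 'rV[R]_q, [/\ a != [::], (size a)%:R <= n
    & (\int[P]_x ((edist_set x [set` a]) `^ r)%:E <= v%:E)%E].

Lemma achievableS {r P n v} n' v' :
  achievable r P n v -> n <= n' -> v <= v' -> achievable r P n' v'.
Proof.
move=> [a [a0 an av]] nn vv; exists a; split => //; first exact: le_trans nn.
by apply: le_trans av _; rewrite lee_fin.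
Qed.

(** The point [g k x] is at distance at most [s k * d(x, a_k)] from the image
of [a_k], so the union of these images serves every piece of the mixture. *)
Lemma achievable_mixture {K : nat} (w s : 'I_K.+1 -> R)
    (Q : 'I_K.+1 -> probability (borel R q) R)
    (g : 'I_K.+1 -> 'rV[R]_q -> 'rV[R]_q)
    (P : probability (borel R q) R) (r : R) (n v : 'I_K.+1 -> R) :
    0 <= r -> (forall k, 0 <= w k) -> (forall k, 0 < s k) ->
    (forall k x y, edist (g k x) (g k y) = s k * edist x y) ->
    mixture w Q g P -> (forall k, achievable r (Q k) (n k) (v k)) ->
  achievable r P (\sum_k n k) (\sum_k w k * s k `^ r * v k).
Proof.
move=> r0 w0 s0 gs PE /choice[a aP].
have an0 k : [set` a k] !=set0.
  by case: (aP k); case: (a k) => // y ? _ _ _; exists y; rewrite /= mem_head.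
pose A := flatten [seq [seq g k y | y <- a k] | k <- enum 'I_K.+1].
have inA k y : y \in a k -> g k y \in A.
  move=> yk; apply/flattenP; exists [seq g k z | z <- a k]; last exact: map_f.
  by apply/mapP; exists k => //; rewrite mem_enum.
have A0 : [set` A] !=set0.
  by have [y yA] := an0 ord0; exists (g ord0 y); exact: inA.
exists A; split.
- by case: A0 => y /=; case: (A).
- rewrite size_flatten /shape -map_comp sumnE big_map big_enum /= natr_sum.
  by apply: ler_sum => k _; rewrite size_map; case: (aP k).
rewrite (@integral_mixture _ _ _ _ w Q g) //; last 3 first.
- by move=> k; exact: measurable_lipschitz (gs k).
- exact: measurable_edist_set_powR.
- by move=> x; rewrite lee_fin powR_ge0.
rewrite -sumEFin; apply: lee_sum => k _.
rewrite -mulrA EFinM; apply: lee_wpmul2l; first by rewrite lee_fin.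
have [_ _ av] := aP k; have sk0 := ltW (s0 k).
apply: (@le_trans _ _ (\int[Q k]_x
    ((s k `^ r)%:E * ((edist_set x [set` a k]) `^ r)%:E))%E); last first.
  rewrite ge0_integralZl_EFin//; last 3 first.
  - by move=> x _; rewrite lee_fin powR_ge0.
  - exact: measurable_edist_set_powR.
  - exact: powR_ge0.
  by rewrite EFinM; apply: lee_wpmul2l; rewrite ?lee_fin ?powR_ge0.
apply: ge0_le_integral => //.
- by move=> x _; rewrite lee_fin powR_ge0.
- apply: (@measurableT_comp _ _ _ _ _ _
    (fun x : borel R q => ((edist_set x [set` A]) `^ r)%:E)).
    exact: measurable_edist_set_powR.
  exact: measurable_lipschitz (gs k).
- apply: measurable_funeM; exact: measurable_edist_set_powR.
move=> x _; rewrite -EFinM lee_fin -powRM ?edist_set_ge0//.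
apply: ge0_ler_powR; rewrite ?nnegrE ?mulr_ge0 ?edist_set_ge0//.
rewrite -ler_pdivrMl//; apply: le_edist_set => // y yk.
by rewrite ler_pdivrMl// -gs; apply: edist_set_le; exact: inA.
Qed.

End Mixtures.

(** * Bounded support *)

Section BoundedSupport.
Context {R : realType} {q : nat}.

Definition origin_ball (rho : R) : set (borel R q) := [set x | edist x 0 < rho].

Definition bounded_measure (P : probability (borel R q) R) : Prop :=
  exists rho : R, P (origin_ball rho) = 1%E.

Lemma measurable_origin_ball rho : measurable (origin_ball rho).
Proof.
have -> : origin_ball rho =
    setT `&` (fun x : borel R q => edist x 0 : R) @^-1` `]-oo, rho[%classic.
  by rewrite setTI; apply/seteqP; split=> x /=; rewrite in_itv.
apply: measurable_lipschitz_real => // x y.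
rewrite ler_norml; have := edist_triangle y x 0; have := edist_triangle x y 0.
by rewrite (edistC y x) => h1 h2; apply/andP; split; lra.
Qed.

#[local] Hint Resolve measurable_origin_ball : core.

Lemma origin_ballS rho rho' :
  rho <= rho' -> origin_ball rho `<=` origin_ball rho'.
Proof. by rewrite /origin_ball => h x /= /lt_le_trans; apply. Qed.

(** Let [m rho] be the mass that [P] gives to the ball of radius [rho] around
the origin. For large [rho], a contraction maps the ball of radius [rho + 1]
into the ball of radius [rho], and a bounded [Q k] gives full mass to the
preimage of the latter. Hence [m rho >= m (rho + 1)], so [m] is constant on
[rho0 + n] for [n] natural; its limit is 1. *)
Lemma bounded_mixture {K : nat} (w s : 'I_K -> R)
    (Q : 'I_K -> probability (borel R q) R)
    (g : 'I_K -> 'rV[R]_q -> 'rV[R]_q) (P : probability (borel R q) R) :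
    prob_vector w -> (forall k, 0 < s k) ->
    (forall k x y, edist (g k x) (g k y) = s k * edist x y) ->
    mixture w Q g P ->
    (forall k, (Q k = P /\ s k < 1) \/ bounded_measure (Q k)) ->
  bounded_measure P.
Proof.
move=> [w0 w1] s0 gs PE QP.
have pull k : exists rho0 : R, forall rho, rho0 <= rho ->
    (P (origin_ball (rho + 1)) <= Q k (g k @^-1` origin_ball rho))%E.
  have gk x : edist (g k x) 0 <= s k * edist x 0 + edist (g k 0) 0.
    by rewrite -gs; exact: edist_triangle.
  have mpre rho : measurable (g k @^-1` origin_ball rho : set (borel R q)).
    have := measurable_lipschitz _ _ (gs k) measurableT
      _ (measurable_origin_ball rho).
    by rewrite setTI.
  case: (QP k) => [[-> sk1]|[rhok Qk1]].
    exists ((edist (g k 0) 0 + s k) / (1 - s k)) => rho.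
    rewrite ler_pdivrMr ?subr_gt0// => rho0.
    apply: le_measure.
      exact: (mem_set (measurable_origin_ball _)).
      exact: (mem_set (mpre _)).
    rewrite /origin_ball => x /= xr; apply: le_lt_trans (gk x) _.
    have : s k * edist x 0 < s k * (rho + 1) by rewrite ltr_pM2l.
    by move=> ?; lra.
  exists (s k * rhok + edist (g k 0) 0) => rho rho0.
  apply: (@le_trans _ _ (Q k (origin_ball rhok))).
    rewrite Qk1; exact: (probability_le1 _ (measurable_origin_ball _)).
  apply: le_measure.
      exact: (mem_set (measurable_origin_ball _)).
      exact: (mem_set (mpre _)).
  rewrite /origin_ball => x /= xr; apply: le_lt_trans (gk x) _.
  by apply: lt_le_trans rho0; rewrite ltrD2r ltr_pM2l.
have /choice[rho_ rhoP] := pull.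
pose rho0 := \sum_k `|rho_ k|.
have rho0P k : rho_ k <= rho0.
  rewrite /rho0 (bigD1 k)//= (le_trans (ler_norm _))// lerDl.
  by apply: sumr_ge0.
have step rho : rho0 <= rho ->
    (P (origin_ball (rho + 1)) <= P (origin_ball rho))%E.
  move=> le_rho; rewrite [leRHS]PE//.
  apply: (@le_trans _ _ (\sum_k (w k)%:E * P (origin_ball (rho + 1)%R))%E).
    by rewrite -ge0_sume_distrl ?sumEFin ?w1 ?mul1e// => k _; rewrite lee_fin.
  apply: lee_sum => k _; apply: lee_wpmul2l; first by rewrite lee_fin.
  by apply: rhoP; exact: le_trans le_rho.
exists rho0; apply/eqP; rewrite eq_le probability_le1//=.
pose B n := origin_ball (rho0 + n%:R).
have BT : \bigcup_n B n = setT.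
  apply/seteqP; split => // x _.
  exists (Num.bound (edist x 0)) => //=.
  rewrite /B /origin_ball /=.
  apply: lt_le_trans (archi_boundP (edist_ge0 x 0)) _.
  by rewrite lerDr; exact: sumr_ge0.
have cvgB : P (B n) @[n --> \oo] --> P (\bigcup_n B n).
  apply: nondecreasing_cvg_mu.
  - by move=> n; exact: measurable_origin_ball.
  - by apply: bigcup_measurable => n _; exact: measurable_origin_ball.
  move=> m n mn; apply/subsetPset; apply: origin_ballS.
  by rewrite lerD2l ler_nat.
have Ble n : (P (B n) <= P (origin_ball rho0))%E.
  elim: n => [|n]; first by rewrite /B addr0.
  apply: le_trans; rewrite /B -(natr1 n) addrA; apply: step.
  by rewrite lerDl.
move: cvgB; rewrite BT probability_setT => cvgB.
rewrite -(cvg_lim _ cvgB)//; apply: lime_le.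
  by apply/cvg_ex; exists 1%E.
by apply: nearW.
Qed.

Lemma bounded_achievable (r : R) (P : probability (borel R q) R) : 0 <= r ->
  bounded_measure P -> exists2 D : R, 0 <= D & achievable r P 1 D.
Proof.
move=> r0 [rho P1].
exists (`|rho| `^ r); first exact: powR_ge0.
exists [:: 0]; split => //.
have zz : [set` [:: 0 : 'rV[R]_q]] !=set0 by exists 0; rewrite /= mem_head.
apply: (@le_trans _ _ (\int[P]_x (`|rho| `^ r)%:E)%E); last first.
  by rewrite integral_cst//= probability_setT mule1.
apply: ae_ge0_le_integral => //.
- by move=> x _; rewrite lee_fin powR_ge0.
- exact: measurable_edist_set_powR.
exists (~` origin_ball rho); split.
- exact: measurableC.
- apply: etrans (probability_setC P (measurable_origin_ball rho)) _.
  by rewrite P1 subee.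
rewrite /origin_ball => x /=; apply: contra_not => /= xr _; rewrite lee_fin.
have x0 : edist_set x [set` [:: 0]] <= edist x 0.
  by apply: edist_set_le; rewrite /= mem_head.
apply: ge0_ler_powR; rewrite ?nnegrE ?edist_set_ge0//.
exact: le_trans x0 (le_trans (ltW xr) (ler_norm _)).
Qed.

End BoundedSupport.

(** * A renewal inequality *)

Section Renewal.
Context {R : realType}.

Lemma exists_uniform_lower_bound {K : nat} (h : 'I_K -> R) :
  (forall k, 0 < h k) -> exists2 l : R, 0 < l <= 1 & forall k, l <= h k.
Proof.
move=> h0; exists (\big[Order.min/1]_k h k); last first.
  by move=> k; exact: bigmin_le_cond.
by rewrite lt_bigmin//= bigmin_le_id.
Qed.

(** Multiplication by [h k] brings a scale back to at most [1] after a number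
of steps that is bounded in terms of the scale only, the [h k] being bounded
away from [1]; it cannot jump below [l]. *)
Lemma scale_induction {K : nat} (h : 'I_K -> R) (l : R) (Q : R -> Prop) :
    0 < l -> (forall k, l <= h k < 1) ->
    (forall x, l <= x <= 1 -> Q x) ->
    (forall x, 1 < x -> (forall k, Q (x * h k)) -> Q x) ->
  forall x, l <= x -> Q x.
Proof.
move=> l0 hl base step.
have [e /andP[e0 e1] eh] : exists2 e : R, 0 < e <= 1 & forall k, e <= 1 - h k.
  apply: exists_uniform_lower_bound => k; rewrite subr_gt0.
  by case/andP: (hl k).
have claim n : forall x, l <= x -> x * (1 - e) ^+ n <= 1 -> Q x.
  elim: n => [|n IH] x lx xn; first by apply: base; rewrite lx -[x]mulr1 xn.
  have [x1|x1] := leP x 1; first by apply: base; rewrite lx.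
  have x0 : 0 < x by apply: lt_trans x1.
  apply: step => // k; have /andP[lh h1] := hl k; apply: IH.
    apply: (le_trans lh); rewrite ler_peMl ?(ltW x1)//.
    exact: le_trans (ltW l0) lh.
  apply: le_trans xn; rewrite -mulrA exprS ler_pM2l//.
  apply: ler_wpM2r; first by rewrite exprn_ge0 ?subr_ge0.
  by rewrite lerBrDl -lerBrDr.
move=> x lx.
have x0 : 0 < x := lt_le_trans l0 lx.
have : `|1 - e| < 1 by rewrite ger0_norm ?subr_ge0// ltrBlDr ltrDl.
move=> /cvg_expr/cvgr0Pnorm_lt/(_ x^-1).
rewrite invr_gt0 => /(_ x0)[n _ /(_ n)].
move=> /(_ (leqnn _)) /=; rewrite ger0_norm ?exprn_ge0 ?subr_ge0// => nx.
by apply: (claim n) => //; rewrite -ler_pdivlMl// mulr1 ltW.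
Qed.

Lemma powR_lt_antimono (h x y : R) : 0 < h < 1 -> x < y -> h `^ y < h `^ x.
Proof.
move=> /andP[h0 h1] xy.
have -> : y = x + (y - x) by ring.
rewrite powRD; last by rewrite (gt_eqF h0) implybT.
rewrite gtr_pMr ?powR_gt0//.
have -> : 1 = 1 `^ (y - x) :> R by rewrite powR1.
by apply: gt0_ltr_powR; rewrite ?subr_gt0 ?nnegrE ?ltW.
Qed.

Lemma powR_ler_nonpos (x y b : R) : 0 < x <= y -> b <= 0 -> y `^ b <= x `^ b.
Proof.
move=> /andP[x0 xy] b0; have y0 := lt_le_trans x0 xy.
rewrite -(opprK b) !(powRN _ (- b)) lef_pV2 ?posrE ?powR_gt0//.
by apply: ge0_ler_powR; rewrite ?nnegrE ?oppr_ge0 ?(ltW x0) ?(ltW y0).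
Qed.

(** [Q n v] stands for the existence of a quantizer with size at most [n] and
cost at most [v]. Since [\sum_k h k `^ eta1 > 1], the subtracted terms
[B * x `^ eta1] and [B * x `^ (eta1 - 1)] grow by that factor at each step, and
the surplus pays for the inhomogeneous terms with coefficient [a]. *)
Lemma renewal {K : nat} (h : 'I_K -> R) (eta eta1 a D : R)
    (Q : R -> R -> Prop) :
    (forall k, 0 < h k < 1) -> \sum_k h k `^ eta = 1 ->
    0 <= eta1 < eta -> eta <= 1 -> 0 <= a -> 0 <= D ->
    (forall n v n' v', Q n v -> n <= n' -> v <= v' -> Q n' v') ->
    Q 1 D ->
    (forall x n v, 1 < x -> (forall k, Q (n k) (v k)) ->
      Q (a * x `^ eta1 + \sum_k n k)
        (a * x `^ (eta1 - 1) + \sum_k h k * v k)) ->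
  exists2 A, 0 < A &
    forall x, 1 <= x -> Q (A * x `^ eta) (A * x `^ (eta - 1)).
Proof.
move=> h01 sumh /andP[eta10 eta1lt] eta_le1 a0 D0 QS Q1 step.
have hgt0 k : 0 < h k by case/andP: (h01 k).
pose S := \sum_k h k `^ eta1.
have S1 : 1 < S.
  rewrite -sumh; apply: ltr_sum; last by move=> k _; exact: powR_lt_antimono.
  case: K h sumh {h01 hgt0 S step} => [|K] h; last first.
    by move=> _; apply/hasP; exists ord0; rewrite ?mem_index_enum.
  by rewrite big_ord0 => /esym/eqP; rewrite oner_eq0.
pose B := a / (S - 1).
have B0 : 0 <= B by rewrite divr_ge0// subr_ge0 ltW.
have BS : a = B * S - B.
  by rewrite -[X in _ - X]mulr1 -mulrBr /B divfK// subr_eq0 gt_eqF.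
have [l /andP[l0 l1] lh] := exists_uniform_lower_bound h hgt0.
(* The three terms of [A] make the bounds hold for the single point at all
   scales in [[l, 1]]. *)
pose A := (1 + B) / l `^ eta + D + B * l `^ (eta1 - 1).
have A1 : 0 < (1 + B) / l `^ eta by rewrite divr_gt0 ?powR_gt0// ltr_pwDl.
have A2 : 0 <= B * l `^ (eta1 - 1) by rewrite mulr_ge0 ?powR_ge0.
have A0 : 0 < A by rewrite /A; lra.
have powM x (b : R) k : 0 < x -> (x * h k) `^ b = x `^ b * h k `^ b.
  by move=> x0; rewrite powRM ?ltW.
have hpow k b : h k * h k `^ (b - 1) = h k `^ b.
  rewrite -{1}[h k]powRr1 ?ltW// -powRD; last first.
    by rewrite (gt_eqF (hgt0 k)) implybT.
  by congr (_ `^ _); ring.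
suff main x : l <= x ->
    Q (A * x `^ eta - B * x `^ eta1) (A * x `^ (eta - 1) - B * x `^ (eta1 - 1)).
  exists A => // x x1; apply: QS (main x (le_trans l1 x1)) _ _;
    by rewrite gerBl mulr_ge0 ?powR_ge0.
move: x; apply: (scale_induction h l (fun x =>
  Q (A * x `^ eta - B * x `^ eta1)
    (A * x `^ (eta - 1) - B * x `^ (eta1 - 1)))) => //.
- by move=> k; rewrite lh; case/andP: (h01 k).
- move=> x /andP[lx x1].
  have x0 : 0 < x := lt_le_trans l0 lx.
  apply: QS Q1 _ _.
    have : 1 + B <= (1 + B) / l `^ eta * x `^ eta.
      rewrite -mulrA ler_peMr ?addr_ge0// mulrC ler_pdivlMr ?powR_gt0// mul1r.
      by apply: ge0_ler_powR; rewrite ?nnegrE ?(ltW l0) ?(ltW x0)//; lra.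
    have : B * x `^ eta1 <= B.
      rewrite ler_piMr//; have -> : 1 = 1 `^ eta1 :> R by rewrite powR1.
      by apply: ge0_ler_powR; rewrite ?nnegrE ?(ltW x0).
    have : (1 + B) / l `^ eta * x `^ eta <= A * x `^ eta.
      by apply: ler_wpM2r; rewrite ?powR_ge0// /A; lra.
    lra.
  have x_1 : 1 <= x `^ (eta - 1).
    by rewrite -[leLHS](powRr0 x); apply: ger_powR; rewrite ?x0// subr_le0.
  have : A <= A * x `^ (eta - 1) by rewrite ler_peMr// ltW.
  have : B * x `^ (eta1 - 1) <= B * l `^ (eta1 - 1).
    apply: ler_wpM2l => //.
    by apply: powR_ler_nonpos; rewrite ?l0//; lra.
  by rewrite /A in A0 *; lra.
move=> x x1 IH.
have x0 : 0 < x by exact: lt_trans x1.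
apply: QS (step _ _ _ x1 IH) _ _.
  rewrite sumrB (eq_bigr (fun k => A * x `^ eta * h k `^ eta)); last first.
    by move=> k _; rewrite powM// mulrA.
  rewrite -mulr_sumr sumh.
  rewrite (eq_bigr (fun k => B * x `^ eta1 * h k `^ eta1)); last first.
    by move=> k _; rewrite powM// mulrA.
  by rewrite -mulr_sumr -/S {1}BS le_eqVlt; apply/orP; left; apply/eqP; ring.
rewrite (eq_bigr (fun k => A * x `^ (eta - 1) * h k `^ eta -
    B * x `^ (eta1 - 1) * h k `^ eta1)); last first.
  by move=> k _; rewrite !powM// -(hpow k eta) -(hpow k eta1); ring.
rewrite sumrB -!mulr_sumr sumh -/S.
by rewrite {1}BS le_eqVlt; apply/orP; left; apply/eqP; ring.
Qed.

End Renewal.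

(** * From quantizers to the quantization coefficient *)

Section QuantizationCoefficient.
Context {R : realType} {q : nat}.
Implicit Types (P nu mu : probability (borel R q) R).

Lemma quant_error_le {r : R} {P} {n : nat} {v : R} : 0 < r ->
  achievable r P n%:R v -> (poweR (quant_error r P n) r <= v%:E)%E.
Proof.
move=> r0 [a [a0 an av]].
have int0 : (0 <= \int[P]_x ((edist_set x [set` a]) `^ r)%:E)%E.
  by apply: integral_ge0 => x _; rewrite lee_fin powR_ge0.
have -> : v%:E = poweR (poweR v%:E r^-1) r.
  rewrite -poweRrM mulVf ?gt_eqF// poweRe1//.
  exact: le_trans av.
apply: gt0_ler_poweR; first exact: ltW.
- rewrite in_itv/= leey andbT; apply: le_ereal_inf_tmp => _ [A _ <-].
  exact: poweR_ge0.
- by have := poweR_ge0 v%:E r^-1; rewrite in_itv/= leey andbT.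
apply: (@le_trans _ _
    (poweR (\int[P]_x ((edist_set x [set` a]) `^ r)%:E) r^-1)).
  apply: ereal_inf_lbound; exists [set` a] => //; split.
    by case: a a0 {an av int0} => // y a _; exists y; rewrite /= mem_head.
  have sub : [set` a] `<=` nth 0 a @` `I_n.
    move=> y /= ya; exists (index y a); last by rewrite nth_index.
    by rewrite /= (leq_trans _ (_ : size a <= n)%N) ?index_mem// -(ler_nat R).
  exact: card_le_trans (subset_card_le sub) (card_image_le _ _).
apply: gt0_ler_poweR; rewrite ?invr_ge0 ?(ltW r0)//.
  by rewrite in_itv/= int0 leey.
by rewrite in_itv/= leey andbT (le_trans int0 av).
Qed.

Lemma upper_quant_coef_lty (r xi A : R) P : 0 < r -> 0 < xi -> 0 < A ->
    (forall x, 1 <= x -> achievable r P (A * x `^ (xi / (xi + r)))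
      (A * x `^ (xi / (xi + r) - 1))) ->
  (upper_quant_coef r xi P < +oo)%E.
Proof.
move=> r0 xi0 A0 Pach; set eta := xi / (xi + r) in Pach.
have xir : 0 < xi + r by exact: addr_gt0.
have eta0 : 0 < eta by rewrite divr_gt0.
apply: (@le_lt_trans _ _ (A * A `^ (r / xi))%:E); last exact: ltry.
rewrite /upper_quant_coef /limn_esup limf_esupE.
apply: (@le_trans _ _ (ereal_sup [set ((n%:R `^ (r / xi))%:E *
    poweR (quant_error r P n) r)%E | n in [set n | (Num.bound A <= n)%N]])).
  apply: ereal_inf_lbound; exists [set n | (Num.bound A <= n)%N] => //.
  by exists (Num.bound A).
apply: ge_ereal_sup => _ [n /= An <-].
have An' : A <= n%:R.
  apply: le_trans (ltW (archi_boundP (ltW A0))) _.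
  by rewrite ler_nat.
have n0 : 0 < n%:R :> R := lt_le_trans A0 An'.
have nA0 : 0 < n%:R / A by rewrite divr_gt0.
(* The scale at which the allowed size [A * x `^ eta] is exactly [n]. *)
pose x := (n%:R / A) `^ eta^-1.
have x1 : 1 <= x.
  have -> : 1 = 1 `^ eta^-1 :> R by rewrite powR1.
  apply: ge0_ler_powR; rewrite ?nnegrE ?invr_ge0 ?(ltW eta0) ?(ltW nA0)//.
  by rewrite ler_pdivlMr// mul1r.
have := Pach x x1; rewrite -!powRrM mulVf ?gt_eqF// powRr1 ?(ltW nA0)//.
rewrite mulrC divfK ?gt_eqF// => /(quant_error_le r0) qn.
apply: le_trans (lee_wpmul2l _ qn) _; first by rewrite lee_fin powR_ge0.
rewrite -EFinM lee_fin.
have -> : eta^-1 * (eta - 1) = - (r / xi).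
  by rewrite /eta; field; rewrite !gt_eqF.
rewrite powRN -{1}[n%:R](divfK (_ : A != 0)) ?gt_eqF//.
rewrite powRM ?(ltW nA0) ?(ltW A0)//.
rewrite le_eqVlt; apply/orP; left; apply/eqP; field.
by rewrite gt_eqF// powR_gt0.
Qed.

(** * Self-similar and in-homogeneous self-similar measures *)

Lemma scaled_weight_lt1 (w s r : R) : 0 < w <= 1 -> 0 < s < 1 -> 0 < r ->
  0 < w * s `^ r < 1.
Proof.
move=> /andP[w0 w1] s01 r0; have /andP[s0 s1] := s01.
rewrite mulr_gt0 ?powR_gt0//=.
have : s `^ r < s `^ 0 by exact: powR_lt_antimono.
by rewrite powRr0; apply: le_lt_trans; rewrite ler_piMl ?powR_ge0.
Qed.

Lemma prob_vector_le1 {n : nat} (p : 'I_n -> R) i : prob_vector p -> p i <= 1.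
Proof.
by move=> [p0 <-]; rewrite (bigD1 i)//= lerDl sumr_ge0.
Qed.

Lemma self_similar_bounded {M : nat} (g : 'I_M -> 'rV[R]_q -> 'rV[R]_q)
    (c t : 'I_M -> R) nu :
    (forall i, contractive_similitude (c i) (g i)) -> prob_vector t ->
    self_similar_measure g t nu ->
  bounded_measure nu.
Proof.
move=> gc tp nuE; apply: (@bounded_mixture _ _ _ t c (fun=> nu) g) => //.
- by move=> k; have [/andP[]] := gc k.
- by move=> k; have [] := gc k.
- by move=> k; left; split=> //; have [/andP[]] := gc k.
Qed.

(** For [a = 0] the renewal inequality says that the bounds reproduce
themselves, which is the classical upper bound for self-similar measures. *)
Lemma self_similar_achievable {M : nat} (g : 'I_M -> 'rV[R]_q -> 'rV[R]_q)
    (c t : 'I_M -> R) nu (r xi : R) :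
    0 < r -> (forall i, contractive_similitude (c i) (g i)) ->
    prob_vector t -> (forall i, 0 < t i) -> self_similar_measure g t nu ->
    xi_eq t c r xi ->
  exists2 A, 0 < A & forall x, 1 <= x ->
    achievable r nu (A * x `^ (xi / (xi + r))) (A * x `^ (xi / (xi + r) - 1)).
Proof.
move=> r0 gc tp t0 nuE [xi0 xiE].
have [D D0 nuD] := bounded_achievable r nu (ltW r0)
  (self_similar_bounded g c t nu gc tp nuE).
have xir : 0 < xi + r by exact: addr_gt0.
apply: (renewal (fun i => t i * c i `^ r) _ 0 0 D) => //.
- move=> k; apply: scaled_weight_lt1; rewrite ?t0 ?prob_vector_le1//.
  by case: (gc k).
- by rewrite lexx divr_gt0.
- by rewrite ler_pdivrMr// mul1r lerDl ltW.
- by move=> n v n' v'; exact: achievableS.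
move=> x n v _ nv; rewrite !mul0r !add0r.
case: M g c t gc tp t0 nuE xiE n v nv => [|M] g c t gc tp t0 nuE _ n v nv.
  by case: tp => _; rewrite big_ord0 => /esym/eqP; rewrite oner_eq0.
apply: (achievable_mixture t c (fun=> nu) g) => //; first exact: ltW.
- by move=> k; exact: ltW.
- by move=> k; have [/andP[]] := gc k.
- by move=> k; have [] := gc k.
Qed.

End QuantizationCoefficient.

(** [mu] is the mixture of [nu], moved by the identity of ratio [1], and of
[N] copies of [mu]; the bounds for [nu] are the inhomogeneous term of the
renewal inequality. *)
Lemma ISM_achievable {R : realType} {q N : nat}
    (f : 'I_N -> 'rV[R]_q -> 'rV[R]_q) (s : 'I_N -> R) (p : 'I_N.+1 -> R)
    (nu mu : probability (borel R q) R) (r eta1 eta2 A : R) :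
    0 < r -> ISM f s p nu mu -> bounded_measure nu -> 0 <= A ->
    0 <= eta1 < eta2 -> eta2 <= 1 ->
    (forall x, 1 <= x ->
      achievable r nu (A * x `^ eta1) (A * x `^ (eta1 - 1))) ->
    \sum_(i < N) (p (lift ord0 i) * s i `^ r) `^ eta2 = 1 ->
  exists2 A', 0 < A' & forall x, 1 <= x ->
    achievable r mu (A' * x `^ eta2) (A' * x `^ (eta2 - 1)).
Proof.
move=> r0 [N2 fs pp p0 _ muE] nuB A0 eta12 eta21 nuA sumh.
pose Q (k : 'I_N.+1) := oapp (fun=> mu) nu (unlift ord0 k).
pose g (k : 'I_N.+1) := oapp f id (unlift ord0 k).
pose c (k : 'I_N.+1) := oapp s 1 (unlift ord0 k).
have c0 k : 0 < c k.
  by rewrite /c; case: unliftP => [i _|_]//=; have [/andP[]] := fs i.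
have gc k x y : edist (g k x) (g k y) = c k * edist x y.
  rewrite /g /c; case: unliftP => [i _|_] /=; last by rewrite mul1r.
  by have [_ ->] := fs i.
have mix : mixture p Q g mu.
  move=> B mB; rewrite (muE B mB) big_ord_recl /Q /g unlift_none.
  congr (_ + _)%E.
  by apply: eq_bigr => i _; rewrite liftK.
have muB : bounded_measure mu.
  apply: (bounded_mixture p c Q g) => // k.
  rewrite /Q /c; case: unliftP => [i _|_] /=; last by right.
  by left; split=> //; have [/andP[]] := fs i.
have [D D0 muD] := bounded_achievable r mu (ltW r0) muB.
apply: (renewal (fun i => p (lift ord0 i) * s i `^ r) _ eta1 A D) => //.
- move=> k; apply: scaled_weight_lt1 => //; last by case: (fs k).
  by rewrite p0 prob_vector_le1.
- by move=> n v n' v'; exact: achievableS.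
move=> x n v x1 nv.
pose n' (k : 'I_N.+1) := oapp n (A * x `^ eta1) (unlift ord0 k).
pose v' (k : 'I_N.+1) := oapp v (A * x `^ (eta1 - 1)) (unlift ord0 k).
have := @achievable_mixture _ _ _ p c Q g mu r n' v' (ltW r0)
  (fun k => ltW (p0 k)) c0 gc mix.
have nv' k : achievable r (Q k) (n' k) (v' k).
  by rewrite /Q /n' /v'; case: unliftP => [i _|_] //=; apply: nuA; exact: ltW.
move=> /(_ nv') mu_ach; apply: achievableS mu_ach _ _;
  rewrite big_ord_recl /n' /v' /c unlift_none /=; apply: lerD.
- by [].
- by apply: ler_sum => i _; rewrite liftK.
- rewrite powR1 mulr1 ler_piMl ?mulr_ge0 ?powR_ge0//.
  exact: prob_vector_le1.
- by apply: ler_sum => i _; rewrite liftK.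
Qed.

Theorem theorem1p1 (R : realType) (q N : nat)
    (f : 'I_N -> 'rV[R]_q -> 'rV[R]_q) (s : 'I_N -> R) (p : 'I_N.+1 -> R)
    (nu mu : probability (borel R q) R) (r xi1 xi2 : R)
    (hq : (1 <= q)%N) (hr : 0 < r)
    (hmu : ISM f s p nu mu)
    (hcase : caseI f s nu r xi1 \/ caseII f nu r xi1)
    (hxi2 : xi_eq (fun i : 'I_N => p (lift ord0 i)) s r xi2)
    (hlt : xi1 < xi2) :
  (upper_quant_coef r (Num.max xi1 xi2) mu < +oo)%E.
Proof.
have [M [g [c [t [gc tp t0 nuE xi1E]]]]] : exists (M : nat)
    (g : 'I_M -> 'rV[R]_q -> 'rV[R]_q) (c t : 'I_M -> R),
    [/\ forall i, contractive_similitude (c i) (g i), prob_vector t,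
      forall i, 0 < t i, self_similar_measure g t nu & xi_eq t c r xi1].
  case: hcase => [[_ [t [tp t0 nuE xi1E]]]|].
    by exists N, f, s, t; split=> //; exact: ISM_similitude hmu.
  by move=> [[M [g [c [t [_ gc _ [tp t0 nuE xi1E]]]]]] _]; exists M, g, c, t.
have [A A0 nuA] := self_similar_achievable g c t nu r xi1 hr gc tp t0 nuE xi1E.
have [xi10 _] := xi1E; have [xi20 xi2E] := hxi2.
have eta12 : 0 <= xi1 / (xi1 + r) < xi2 / (xi2 + r).
  rewrite divr_ge0 ?addr_ge0 ?ltW//= ltr_pdivrMr ?addr_gt0//.
  rewrite mulrAC ltr_pdivlMr ?addr_gt0//; nra.
have eta21 : xi2 / (xi2 + r) <= 1.
  by rewrite ler_pdivrMr ?addr_gt0// mul1r lerDl ltW.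
have [A' A'0 muA] := ISM_achievable f s p nu mu r _ _ A hr hmu
  (self_similar_bounded g c t nu gc tp nuE) (ltW A0) eta12 eta21 nuA xi2E.
rewrite max_r; last exact: ltW.
exact: (upper_quant_coef_lty r xi2 A' mu).
Qed.
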